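(* Let $\mathbf{p}=\mathbf{p}(n)=(p_{11},p_{10},p_{01},p_{00})$ be probability vectors depending on $n$ that satisfy, as $n\to\infty$, $$p_{11}\ge \frac{\log n+\omega(1)}{n},\qquad p_{11}\le \mathcal{O}\left(\frac{1}{\log n}\right),\qquad p_{01}+p_{10}\le \mathcal{O}\left(\frac{1}{\log n}\right),\qquad \frac{p_{01}p_{10}}{p_{11}p_{00}}\le \mathcal{O}\left(\frac{1}{(\log n)^3}\right).$$ Let $(G_a,G_b)\sim ER(n,\mathbf{p})$, let $\Pi$ be a uniformly random permutation of $[n]$ independent of $(G_a,G_b)$, and let $G_c$ be the anonymization of $G_a$ by $\Pi$. Then there is an estimator for $\Pi$ given $(G_c,G_b)$ that is correct (i.e. equals $\Pi$) with probability $1-o(1)$.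
   Context: $[n]=\{0,1,\dots,n-1\}$, and $\binom{[n]}{2}$ is the set of two-element subsets of $[n]$. A graph on $[n]$ is identified with its edge indicator function $g:\binom{[n]}{2}\to\{0,1\}$. $ER(n,\mathbf{p})$ is the distribution of a pair of graphs $(G_a,G_b)$ on $[n]$ such that the pairs $(G_a(e),G_b(e))$, $e\in\binom{[n]}{2}$, are i.i.d. and $(G_a(e),G_b(e))=(i,j)$ with probability $p_{ij}$ for $i,j\in\{0,1\}$ (entries of $\mathbf{p}$ nonnegative, summing to 1). The anonymization $G_c$ of $G_a$ by $\Pi$ is given by $G_c(\{\Pi(i),\Pi(j)\})=G_a(\{i,j\})$ for all $i\neq j$. An estimator for $\Pi$ given $(G_c,G_b)$ is a (possibly randomized) function of $(G_c,G_b)$ with values in the permutations of $[n]$. $\log$ is the natural logarithm; asymptotic notation is as $n\to\infty$, and $\omega(1)$ denotes a quantity tending to $+\infty$. *)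

(* Defs.v *)
From HB Require Import structures.
From mathcomp Require Import all_boot all_order all_algebra all_fingroup.
From mathcomp Require Import all_classical all_reals all_analysis.

Set Implicit Arguments.
Unset Strict Implicit.
Unset Printing Implicit Defensive.

Import Order.TTheory GRing.Theory Num.Theory.
Import numFieldNormedType.Exports.

Local Open Scope ring_scope.

Record fdist (R : realType) (A : finType) := Fdist {
  pmf :> A -> R;
  pmf_ge0 : forall a, 0 <= pmf a;
  pmf_sum1 : \sum_a pmf a = 1 }.

Definition Pr (R : realType) (A : finType) (d : fdist R A) (E : pred A) : R :=
  \sum_(a | E a) d a.

Section Chain.
Variables (R : realType) (A B : finType) (d : fdist R A) (K : A -> fdist R B).

Let f (ab : A * B) : R := d ab.1 * K ab.1 ab.2.

Fact chain_ge0 ab : 0 <= f ab.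
Proof. by rewrite mulr_ge0 ?pmf_ge0. Qed.

Fact chain_sum1 : \sum_ab f ab = 1.
Proof.
rewrite -(pair_bigA _ (fun a b => d a * K a b)) /= -(pmf_sum1 d).
by apply: eq_bigr => a _; rewrite -big_distrr /= pmf_sum1 mulr1.
Qed.

(* The law of (a, b) where a ~ d and, conditionally on a, b ~ K a; for a
   constant K this is the law of an independent pair. *)
Definition chain : fdist R (A * B)%type := Fdist chain_ge0 chain_sum1.

End Chain.

Section Uniform.
Variables (R : realType) (n : nat).

Fact unif_perm_ge0 (s : 'S_n) : 0 <= (n`!%:R)^-1 :> R.
Proof. by rewrite invr_ge0 ler0n. Qed.

Fact unif_perm_sum1 : \sum_(s : 'S_n) (n`!%:R)^-1 = 1 :> R.
Proof.
by rewrite sumr_const card_Sn -[_ *+ _]mulr_natr mulVf //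
  pnatr_eq0 -lt0n fact_gt0.
Qed.

Definition unif_perm : fdist R 'S_n := Fdist unif_perm_ge0 unif_perm_sum1.

End Uniform.

Definition vpair (n : nat) : finType := {e : {set 'I_n} | #|e| == 2}.

Definition graph (n : nat) : finType := {ffun vpair n -> bool}.

Fact mkpair_subproof n (i j : 'I_n) : i != j -> #|[set i; j]| == 2.
Proof. by move=> ij; rewrite cards2 ij. Qed.

Definition mkpair n (i j : 'I_n) (ij : i != j) : vpair n :=
  Sub [set i; j] (mkpair_subproof ij).

Fact perm_pair_subproof n (s : 'S_n) (e : vpair n) : #|s @: val e| == 2.
Proof. by rewrite card_imset ?(valP e) //; exact: perm_inj. Qed.

Definition perm_pair n (s : 'S_n) (e : vpair n) : vpair n :=
  Sub (s @: val e) (perm_pair_subproof s e).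

Definition anonymize n (s : 'S_n) (g : graph n) : graph n :=
  [ffun e => g (perm_pair s^-1%g e)].

Lemma anonymizeE n (s : 'S_n) (g : graph n) (i j : 'I_n)
    (ij : i != j) (sij : s i != s j) :
  anonymize s g (mkpair sij) = g (mkpair ij).
Proof.
rewrite ffunE; congr (g _); apply: val_inj => /=.
by rewrite imsetU1 imset_set1 !permK.
Qed.

Section ER.
Variables (R : realType) (n : nat) (p : fdist R (bool * bool)%type).

Let f (G : graph n * graph n) : R := \prod_(e : vpair n) p (G.1 e, G.2 e).

Fact ER_ge0 G : 0 <= f G.
Proof. by apply: prodr_ge0 => e _; exact: pmf_ge0. Qed.

Fact ER_sum1 : \sum_G f G = 1.
Proof.
pose h (F : {ffun vpair n -> bool * bool}) : graph n * graph n :=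
  ([ffun e => (F e).1], [ffun e => (F e).2]).
pose k (G : graph n * graph n) : {ffun vpair n -> bool * bool} :=
  [ffun e => (G.1 e, G.2 e)].
have hk : {on [pred _ | true], bijective h}.
  apply: onW_bij; exists k => [F|[G1 G2]].
    by apply/ffunP => e; rewrite !ffunE /=; case: (F e).
  by rewrite /h /k; congr pair; apply/ffunP => e; rewrite !ffunE.
rewrite (reindex h) //= (eq_bigr (fun F : {ffun vpair n -> bool * bool} =>
  \prod_(e : vpair n) p (F e))); last first.
  by move=> F _; apply: eq_bigr => e _; rewrite !ffunE /=; case: (F e).
rewrite -(bigA_distr_bigA (fun=> p)) /=.
by rewrite big1 // => e _; rewrite pmf_sum1.
Qed.

Definition ER : fdist R (graph n * graph n)%type := Fdist ER_ge0 ER_sum1.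

End ER.

(* A randomized estimator sends the observed pair (G_c, G_b) to the law of its
   output; a deterministic one is the case of point masses. *)
Definition estimator (R : realType) (n : nat) : Type :=
  graph n * graph n -> fdist R 'S_n.

(* The joint law of (((G_a, G_b), Pi), output of the estimator). *)
Definition experiment (R : realType) (n : nat) (p : fdist R (bool * bool)%type)
    (est : estimator R n) :
    fdist R ((graph n * graph n) * 'S_n * 'S_n)%type :=
  chain (chain (ER n p) (fun=> unif_perm R n))
        (fun x => est (anonymize x.2 x.1.1, x.1.2)).

Definition Pr_correct (R : realType) (n : nat)
    (p : fdist R (bool * bool)%type) (est : estimator R n) : R :=
  Pr (experiment p est) (fun x => x.2 == x.1.2).

(* Main.v *)
(** The estimator maximizes the number of edges common to the realigned [G_c] and
[G_b].  It errs only if, for some [s != 1], the [X] spurious coincidences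
[G_a (s e) && G_b e] over the pairs [e] moved by [s] are at least as many as the
[Y] true common edges among these pairs.  Write [k] for the size of the support
of [s] and [L = ln n].

For [k <= 32 n / L], use [P(X >= Y) <= E z^(X - Y)] with [z = L].  The
expectation is a product over the cycles of [s] on pairs of traces of powers of a
2x2 matrix, and a trace of the [l]-th power with [l >= 2] is at most the [l/2]-th
power of the trace of the square.  This gives [exp (- k (L + w/2 - O(1)))], which
beats the number [n^k] of such permutations.

For larger [k] the union bound over [s] fails because of rare events of few
common edges, shared by many permutations.  Those events only depend on the
support, so a union over the [2^n] sets of vertices shows that every large set
meets enough common edges.  The event that [X] alone reaches this number has
probability at most [exp (- 2 k L)], by the same trace bound for [E z^X]. *)

Require Import Defs.
From HB Require Import structures.
From mathcomp Require Import all_boot all_order all_algebra all_fingroup.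
From mathcomp Require Import all_classical all_reals all_analysis.
From mathcomp Require Import ring lra.
Import Order.TTheory GRing.Theory Num.Theory.
Import numFieldNormedType.Exports.
Local Open Scope ring_scope.

(** * Sums over colorings weighted along the cycles of a permutation *)

Lemma prod_porbits (R : comNzRingType) (E : finType) (tau : {perm E}) (F : E -> R) :
  \prod_e F e = \prod_(O in porbits tau) \prod_(e in O) F e.
Proof.
rewrite (partition_big (porbit tau) (mem (porbits tau))) /=; last first.
  by move=> e _; apply: imset_f.
apply: eq_bigr => O /imsetP[y _ ->].
by apply: eq_bigl => e; rewrite eq_porbit_mem.
Qed.

(** An invariant coloring is constant on every cycle, so it amounts to one color per cycle.
    Distributivity turns the sum over these choices into a product over cycles. *)
Lemma sum_invariant_porbits (R : comNzRingType) (E : finType) (tau : {perm E})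
    (lam : E -> bool -> R) :
  \sum_(G : {ffun E -> bool} | [forall e, G (tau e) == G e]) \prod_e lam e (G e) =
  \prod_(O in porbits tau) \sum_s \prod_(e in O) lam e s.
Proof.
rewrite (big_distr_big_dep false) /=.
(* [h] must vanish outside [porbits tau]: the families produced by [big_distr_big_dep] take the
   default color [false] there. *)
pose h (G : {ffun E -> bool}) : {ffun {set E} -> bool} :=
  [ffun O : {set E} => (O \in porbits tau) &&
     (if [pick x in O] is Some x then G x else false)].
pose g (H : {ffun {set E} -> bool}) : {ffun E -> bool} :=
  [ffun e => H (porbit tau e)].
have inv_iter (G : {ffun E -> bool}) : [forall e, G (tau e) == G e] ->
    forall x y, y \in porbit tau x -> G y = G x.
  move=> /forallP GP x y /porbitP[i ->]; elim: i => [|i IH]; first by rewrite expg0 perm1.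
  by rewrite expgSr permM (eqP (GP _)).
rewrite [RHS](reindex_onto h g) /=; last first.
  move=> H /pfamilyP[Hs _]; apply/ffunP => O; rewrite !ffunE.
  case: (boolP (O \in porbits tau)) => /= [OP|OP]; last first.
    apply/esym/negbTE; apply: contra OP => HO.
    by have := fintype.subsetP Hs O; rewrite inE /= HO; apply.
  case: pickP => [x xO|O0].
    case/imsetP: OP => y _ eO; rewrite ffunE eO; congr (H _).
    by apply/eqP; rewrite eq_porbit_mem -eO.
  by case/imsetP: OP => y _ eO; have := O0 y; rewrite eO porbit_id.
have ghK (G : {ffun E -> bool}) : [forall e, G (tau e) == G e] -> g (h G) = G.
  move=> GP; apply/ffunP => e; rewrite !ffunE imset_f //=.
  case: pickP => [x /inv_iter -> //|/(_ e)]; by rewrite porbit_id.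
apply: eq_big => [G|G GP].
  apply/idP/idP => [GP|/andP[_ /eqP <-]].
    rewrite ghK // eqxx andbT; apply/pfamilyP; split.
      by apply/fintype.subsetP => O; rewrite inE /= ffunE; case: (O \in _).
    by [].
  apply/forallP => e; rewrite !ffunE; set a := porbit _ _; set b := porbit _ _.
  suff -> : a = b by [].
  by apply/eqP; rewrite eq_porbit_mem -{1}[tau]expg1 mem_porbit.
rewrite (prod_porbits _ _ tau); apply: eq_bigr => O OP.
apply: eq_bigr => e eO; rewrite !ffunE OP /=; congr (lam _ _).
case/imsetP: OP eO => y _ -> eO.
case: pickP => [x xO|/(_ e)]; last by rewrite eO.
by rewrite (inv_iter _ GP _ _ xO) (inv_iter _ GP _ _ eO).
Qed.

(* Both sides are the trace of [tau] composed with the tensor product of the matrices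
   [P e * diag (lam e) * Q e]; conjugating by the tensor product of the [P e], which
   commutes with [tau], leaves only the colorings invariant under [tau]. *)
Lemma perm_trace (R : comNzRingType) (E : finType) (tau : {perm E})
    (P Q : E -> bool -> bool -> R) (lam : E -> bool -> R) :
  (forall e, P (tau e) = P e) ->
  (forall e s s', \sum_b Q e s b * P e b s' = (s == s')%:R) ->
  \sum_(F : {ffun E -> bool})
     \prod_e \sum_s P e (F e) s * lam e s * Q e s (F (tau e)) =
  \prod_(O in porbits tau) \sum_s \prod_(e in O) lam e s.
Proof.
move=> Ptau QP; rewrite -sum_invariant_porbits.
transitivity (\sum_(F : {ffun E -> bool}) \sum_(G : {ffun E -> bool})
   \prod_e (P e (F e) (G e) * lam e (G e) * Q e (G e) (F (tau e)))).
  by apply: eq_bigr => F _; rewrite bigA_distr_bigA.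
rewrite exchange_big /= [RHS]big_mkcond /=; apply: eq_bigr => G _.
transitivity (\sum_(F : {ffun E -> bool})
   (\prod_e lam e (G e)) * \prod_e (Q e (G e) (F (tau e)) * P e (F (tau e)) (G (tau e)))).
  apply: eq_bigr => F _.
  rewrite !big_split /= -(mulrC (\prod_i lam _ _)) -!mulrA; congr (_ * _).
  rewrite mulrC; congr (_ * _).
  rewrite (reindex_inj (@perm_inj _ tau)) /=; apply: eq_bigr => e _.
  by rewrite Ptau.
rewrite -big_distrr /=.
rewrite (reindex (fun F : {ffun E -> bool} => [ffun e => F ((tau^-1)%g e)])) /=; last first.
  apply: onW_bij; exists (fun F : {ffun E -> bool} => [ffun e => F (tau e)]).
    by move=> F; apply/ffunP => e; rewrite !ffunE permK.
  by move=> F; apply/ffunP => e; rewrite !ffunE permKV.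
rewrite (eq_bigr (fun F : {ffun E -> bool} =>
    \prod_e (Q e (G e) (F e) * P e (F e) (G (tau e))))) => [|F _]; last first.
  by apply: eq_bigr => e _; rewrite !ffunE permK.
rewrite -(bigA_distr_bigA (fun e b => Q e (G e) b * P e b (G (tau e)))) /=.
rewrite [X in _ * X](eq_bigr (fun e => (G e == G (tau e))%:R)) => [|e _]; last by rewrite QP.
case: ifPn => [/forallP GP|].
  by rewrite [X in _ * X]big1 ?mulr1 // => e _; rewrite eq_sym GP.
rewrite negb_forall => /existsP[e eP].
by rewrite [X in _ * X](bigD1 e) //= eq_sym (negbTE eP) mul0r mulr0.
Qed.

(** A positive product of the off-diagonal entries makes the discriminant positive, so the two
    eigenvalues are real and distinct. The sum of their squares is the trace of the square of
    [T]. *)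
Lemma diagonalize2 (R : rcfType) (T : bool -> bool -> R) :
  0 < T false true * T true false ->
  exists (P Q : bool -> bool -> R) (lam : bool -> R),
  [/\ forall a b, \sum_s P a s * lam s * Q s b = T a b,
      forall s s', \sum_b Q s b * P b s' = (s == s')%:R &
      lam false ^+ 2 + lam true ^+ 2 =
        T false false ^+ 2 + 2 * (T false true * T true false) + T true true ^+ 2].
Proof.
set a := T false false; set b := T false true; set c := T true false; set d := T true true.
move=> bc0.
have disc0 : 0 < (a - d) ^+ 2 + 4 * (b * c) by have := sqr_ge0 (a - d); lra.
pose r := Num.sqrt ((a - d) ^+ 2 + 4 * (b * c)).
have r0 : 0 < r by rewrite sqrtr_gt0.
have r2 : r ^+ 2 = (a - d) ^+ 2 + 4 * (b * c) by rewrite sqr_sqrtr // ltW.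
have bN0 : b != 0 by apply: contraL bc0 => /eqP ->; rewrite mul0r ltxx.
have rN0 : r != 0 by rewrite gt_eqF.
have cE : c = (r ^+ 2 - (a - d) ^+ 2) / (4 * b).
  by apply: (mulfI bN0); rewrite r2; field.
(* The roots of the characteristic polynomial. Column [s] of [P] is the eigenvector
   [(b, lam s - a)], and [Q] is the inverse of [P]. *)
pose lam s : R := if s then (a + d + r) / 2 else (a + d - r) / 2.
pose P x s : R := if x then lam s - a else b.
pose Q s y : R := match s, y with
  | false, false => (lam true - a) / (b * r) | false, true => - r^-1
  | true, false => - (lam false - a) / (b * r) | true, true => r^-1 end.
exists P, Q, lam; split; last first.
- by rewrite cE /lam -/a -/d -/b; field.
- by case; case; rewrite big_bool /P /Q /lam /=; field; rewrite ?rN0 ?bN0.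
- case; case; rewrite big_bool /P /Q /lam /= -/a -/b -/c -/d ?cE; field; rewrite ?rN0 ?bN0 //.
Qed.

(** Bounds the trace attached to a cycle of length [l]. Both [|x|] and [|y|] are at most [c], so all
    but two factors of each power can be replaced by [c]. *)
Lemma norm_sum_pow_le (R : realFieldType) (x y c : R) (l : nat) :
  0 <= c -> x ^+ 2 + y ^+ 2 <= c ^+ 2 -> (1 < l)%N -> `|x ^+ l + y ^+ l| <= c ^+ l.
Proof.
move=> c0 xyc; case: l => [|[|l]] // _.
have xc : `|x| <= c.
  by rewrite -ler_sqr ?nnegrE // real_normK ?num_real //; have := sqr_ge0 y; lra.
have yc : `|y| <= c.
  by rewrite -ler_sqr ?nnegrE // real_normK ?num_real //; have := sqr_ge0 x; lra.
have E : forall z : R, `|z ^+ l.+2| = `|z| ^+ l * z ^+ 2.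
  by move=> z; rewrite normrX -[l.+2]addn2 exprD [`|z| ^+ 2]real_normK ?num_real.
apply: le_trans (ler_normD _ _) _; rewrite !E.
apply: (@le_trans _ _ (c ^+ l * x ^+ 2 + c ^+ l * y ^+ 2)).
  by apply: lerD; apply: ler_wpM2r; rewrite ?sqr_ge0 // lerXn2r ?nnegrE.
by rewrite -mulrDr -[l.+2]addn2 exprD; apply: ler_wpM2l; rewrite ?exprn_ge0.
Qed.

(* The quadratic expression bounded by [c ^+ 2] is the trace of the square of [T]. *)
Lemma perm_sum_le (R : rcfType) (E : finType) (tau : {perm E})
    (T : bool -> bool -> R) (r : bool -> R) (c : R) :
  r false + r true = 1 -> 0 < T false true * T true false -> 0 <= c ->
  T false false ^+ 2 + 2 * (T false true * T true false) + T true true ^+ 2 <= c ^+ 2 ->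
  `|\sum_(F : {ffun E -> bool})
     \prod_e (if tau e != e then T (F e) (F (tau e)) else r (F e))|
  <= c ^+ #|[set e | tau e != e]|.
Proof.
move=> r1 T0 c0 Tc.
have [P [Q [lam [TE QP lamE]]]] := diagonalize2 _ _ T0.
(* At fixed points the change of basis is the identity and the weights are [r], so [perm_trace]
   treats moved and fixed points at once. *)
pose P' e a s := if tau e != e then P a s else (a == s)%:R.
pose Q' e s b := if tau e != e then Q s b else (s == b)%:R.
pose lam' e s := if tau e != e then lam s else r s.
have -> : \sum_(F : {ffun E -> bool})
     \prod_e (if tau e != e then T (F e) (F (tau e)) else r (F e)) =
   \sum_(F : {ffun E -> bool})
     \prod_e \sum_s P' e (F e) s * lam' e s * Q' e s (F (tau e)).
  apply: eq_bigr => F _; apply: eq_bigr => e _; rewrite /P' /Q' /lam'.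
  case: ifPn => [_|/negPn/eqP ->]; first by rewrite TE.
  by rewrite big_bool; case: (F e); rewrite /= !(mul0r, mul1r, mulr0, mulr1, addr0, add0r).
have QP' e s s' : \sum_b Q' e s b * P' e b s' = (s == s')%:R.
  rewrite /P' /Q'; case: (tau e != e); first exact: QP.
  by rewrite big_bool; case: s; case: s'; rewrite /= !(mul0r, mul1r, mulr0, mulr1, addr0, add0r).
rewrite perm_trace // => [|e]; last by rewrite /P' (inj_eq (@perm_inj _ tau)).
have -> : c ^+ #|[set e | tau e != e]| = \prod_e (if tau e != e then c else 1).
  rewrite -big_mkcond prodr_const; congr (_ ^+ _); by apply: eq_card => e; rewrite inE.
rewrite (prod_porbits _ _ tau) normr_prod; apply: ler_prod => O /imsetP[x _ ->].
rewrite normr_ge0 /=.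
have movE e : e \in porbit tau x -> (tau e != e) = (tau x != x).
  case/porbitP => i ->; congr negb.
  by rewrite -permM -expgSr expgS permM (inj_eq (@perm_inj _ _)).
rewrite [leRHS](eq_bigr (fun=> if tau x != x then c else 1)) => [|e ex]; last by rewrite (movE e ex).
have -> : \sum_s \prod_(e in porbit tau x) lam' e s =
   \sum_s (if tau x != x then lam s else r s) ^+ #|porbit tau x|.
  apply: eq_bigr => s _; rewrite -prodr_const; apply: eq_bigr => e ex.
  by rewrite /lam' (movE e ex).
rewrite prodr_const big_bool.
(* A moved cycle contains the distinct points [x] and [tau x], so its length is at least 2. A fixed
   point contributes the factor [r false + r true = 1]. *)
case: (boolP (tau x != x)) => [mx|/negPn/eqP fx].
  apply: norm_sum_pow_le => //; first by rewrite addrC lamE.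
  rewrite (cardD1 x) porbit_id (cardD1 (tau x)) !inE mx.
  by have := mem_porbit tau 1 x; rewrite expg1 => ->.
have -> : porbit tau x = [set x].
  apply/setP => y; rewrite inE; apply/idP/eqP => [/porbitP[i ->]|->]; last exact: porbit_id.
  by elim: i => [|i IH]; rewrite ?expg0 ?perm1 // expgSr permM IH.
by rewrite cards1 !expr1 /= addrC r1 normr1.
Qed.

(** * Moment generating functions of the edge counts *)

Lemma perm_pairM n (s t : 'S_n) (e : vpair n) :
  perm_pair (s * t)%g e = perm_pair t (perm_pair s e).
Proof.
apply: val_inj => /=; rewrite -imset_comp; apply: eq_imset => x /=.
by rewrite permM.
Qed.

Lemma perm_pair1 n (e : vpair n) : perm_pair 1%g e = e.
Proof.
apply: val_inj => /=; rewrite -[RHS]imset_id; apply: eq_imset => x /=.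
by rewrite perm1.
Qed.

Lemma perm_pair_inj {n} (s : 'S_n) : injective (perm_pair s).
Proof.
by apply: (can_inj (g := perm_pair s^-1%g)) => e; rewrite -perm_pairM mulgV perm_pair1.
Qed.

Definition moved {n} (s : 'S_n) : {set vpair n} := [set e | perm_pair s e != e].

Definition common_edges {n} (M : {set vpair n}) (G : graph n * graph n) : nat :=
  \sum_(e in M) (G.1 e && G.2 e).

Definition spurious_edges {n} (s : 'S_n) (G : graph n * graph n) : nat :=
  \sum_(e in moved s) (G.1 (perm_pair s e) && G.2 e).

Lemma Pr_le_mean (R : realType) (A : finType) (d : fdist R A) (B : pred A) (f : A -> R) :
  (forall a, 0 <= f a) -> (forall a, B a -> 1 <= f a) -> Pr d B <= \sum_a d a * f a.
Proof.
move=> f0 f1; rewrite /Pr big_mkcond /=; apply: ler_sum => a _.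
case: ifPn => [Ba|_]; last by rewrite mulr_ge0 ?Defs.pmf_ge0.
by rewrite ler_peMr ?Defs.pmf_ge0 ?f1.
Qed.

(** The factor at [e] sees the second graph only at [e], so for a fixed first graph the second one
    is summed out pair by pair. *)
Lemma sum_graph_pair (R : comNzRingType) n (h : vpair n -> graph n -> bool -> R) :
  \sum_(G : graph n * graph n) \prod_e h e G.1 (G.2 e) =
  \sum_(a : graph n) \prod_e \sum_b h e a b.
Proof.
rewrite -(pair_bigA _ (fun a b : graph n => \prod_e h e a (b e))) /=.
by apply: eq_bigr => a _; rewrite bigA_distr_bigA.
Qed.

Lemma mgf_common (R : realType) n (p : fdist R (bool * bool)%type)
    (M : {set vpair n}) (u : R) :
  \sum_G ER n p G * u ^+ common_edges M G =
  (1 - (1 - u) * p (true, true)) ^+ #|M|.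
Proof.
pose h (e : vpair n) (a : graph n) b : R :=
  p (a e, b) * (if e \in M then u ^+ (a e && b) else 1).
transitivity (\sum_(G : graph n * graph n) \prod_e h e G.1 (G.2 e)).
  apply: eq_bigr => G _; rewrite /= big_split /=; congr (_ * _).
  by rewrite /common_edges expr_sum [LHS]big_mkcond.
rewrite sum_graph_pair /h.
rewrite -(bigA_distr_bigA (fun (e : vpair n) (x : bool) =>
   \sum_b p (x, b) * (if e \in M then u ^+ (x && b) else 1))) /=.
rewrite -prodr_const [RHS]big_mkcond /=; apply: eq_bigr => e _.
have p1 : \sum_x \sum_y p (x, y) = 1.
  by rewrite pair_bigA -(Defs.pmf_sum1 p); apply: eq_bigr => -[].
rewrite !big_bool /= in p1 *; case: ifP => _ /=; rewrite ?expr0 ?expr1; lra.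
Qed.

(** Once the second graph is summed out, the weight at a moved pair [e] depends on the first graph
    only at [e] and [perm_pair s e]. The expectation is thus a product of traces along the cycles of
    [s] on pairs, and the last hypothesis bounds the trace of the squared transfer matrix. *)
Lemma mgf_moved (R : realType) n (p : fdist R (bool * bool)%type) (s : 'S_n) (z u c : R) :
  0 < z -> 0 < u -> 0 <= c -> 0 < p (false, false) -> 0 < p (true, true) ->
  (p (false, false) + p (false, true)) ^+ 2 +
  2 * ((p (false, false) + z * p (false, true)) * (p (true, false) + u * p (true, true))) +
  (p (true, false) + z * u * p (true, true)) ^+ 2 <= c ^+ 2 ->
  \sum_G ER n p G * (z ^+ spurious_edges s G * u ^+ common_edges (moved s) G)
  <= c ^+ #|moved s|.
Proof.
move=> z0 u0 c0 p00 p11 t2.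
pose h (e : vpair n) (a : graph n) b : R :=
  p (a e, b) * (if e \in moved s then z ^+ (a (perm_pair s e) && b) * u ^+ (a e && b) else 1).
have -> : \sum_G ER n p G * (z ^+ spurious_edges s G * u ^+ common_edges (moved s) G)
  = \sum_(G : graph n * graph n) \prod_e h e G.1 (G.2 e).
  apply: eq_bigr => G _; rewrite /= big_split /=; congr (_ * _).
  by rewrite /common_edges /spurious_edges !expr_sum -big_split [LHS]big_mkcond.
rewrite sum_graph_pair.
(* [T] is the transfer matrix at a moved pair, [r] the marginal law of the first graph at a fixed
   one. *)
pose T (x y : bool) : R := \sum_b p (x, b) * (z ^+ (y && b) * u ^+ (x && b)).
pose r (x : bool) : R := \sum_b p (x, b).
pose tau := perm (perm_pair_inj s).
have -> : \sum_(a : graph n) \prod_e \sum_b h e a b =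
  \sum_(F : {ffun vpair n -> bool})
     \prod_e (if tau e != e then T (F e) (F (tau e)) else r (F e)).
  apply: eq_bigr => a _; apply: eq_bigr => e _; rewrite /h inE permE.
  case: ifP => _; rewrite /T /r //.
  by apply: eq_bigr => b _; rewrite mulr1.
have p01 := Defs.pmf_ge0 p (false, true); have p10 := Defs.pmf_ge0 p (true, false).
have -> : moved s = [set e | tau e != e] by apply/setP => e; rewrite !inE permE.
apply: le_trans (ler_norm _) _; apply: perm_sum_le => //.
- have p1 : \sum_x \sum_y p (x, y) = 1.
    by rewrite pair_bigA -(Defs.pmf_sum1 p); apply: eq_bigr => -[].
  by move: p1; rewrite /r !big_bool /=; lra.
- rewrite /T !big_bool /= !(expr0, expr1, mulr1, mul1r).
  have zp01 : 0 <= z * p (false, true) by rewrite mulr_ge0 // ltW.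
  have up11 : 0 < u * p (true, true) by rewrite mulr_gt0.
  by apply: mulr_gt0; lra.
- rewrite /T !big_bool /= !(expr0, expr1, mulr1, mul1r).
  apply: le_trans t2; rewrite le_eqVlt; apply/orP; left; apply/eqP; ring.
Qed.

(** * Counting moved pairs and permutations *)

Definition supp {n} (s : 'S_n) : {set 'I_n} := [set i | s i != i].

(** Unlike [moved s], this set is determined by vertices alone, which allows a union bound over
    vertex sets instead of permutations. *)
Definition touching {n} (S : {set 'I_n}) : {set vpair n} :=
  [set e | val e :&: S != finset.set0].

(** Double counting: every pair has two endpoints. *)
Lemma sum_incident n (M : {set vpair n}) :
  (\sum_i #|[set e in M | i \in val e]| = 2 * #|M|)%N.
Proof.
under eq_bigr => i _ do rewrite -sum1dep_card.
rewrite (exchange_big_dep (mem M)) /= => [|i e _ /andP[] //].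
under eq_bigr => e eM.
  rewrite eM /= sum1_card (eqP (valP e)).
  over.
by rewrite sum_nat_const mulnC.
Qed.

Lemma card_incident n (M : {set vpair n}) (i : 'I_n) (J : {set 'I_n}) :
  (forall j, j \in J -> exists ij : i != j, mkpair ij \in M) ->
  (#|J| <= #|[set e in M | i \in val e]|)%N.
Proof.
move=> JM.
have iJ : i \notin J by apply/negP => /JM[ii _]; move: (ii); rewrite eqxx.
rewrite -(card_in_imset (f := fun j => [set i; j])); last first.
  move=> j k jJ kJ /= /setP /(_ j); rewrite !inE eqxx orbT.
  by case: eqP => [ji|_]; [rewrite -ji jJ in iJ | move=> /esym /eqP].
rewrite -(card_imset _ (@val_inj _ _ (vpair n))); apply/subset_leq_card/fintype.subsetP => A /imsetP[j jJ ->].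
have [ij eM] := JM _ jJ.
by apply/imsetP; exists (mkpair ij) => //; rewrite inE eM /= !inE eqxx.
Qed.

Lemma mkpair_moved n (s : 'S_n) (i j : 'I_n) (ij : i != j) :
  s i != i -> s i != j -> mkpair ij \in moved s.
Proof.
move=> sii sij; rewrite inE; apply/negP => /eqP /(congr1 val) /= /setP /(_ (s i)).
by rewrite imset_f ?inE ?eqxx // (negbTE sii) (negbTE sij).
Qed.

Lemma mkpair_sym n (i j : 'I_n) (ij : i != j) (ji : j != i) : mkpair ij = mkpair ji.
Proof. by apply: val_inj; rewrite /= finset.setUC. Qed.

(** A moved vertex [i] forms a moved pair with every vertex except [i] and [s i]; the pair
    [{i, s i}] may be swapped. A fixed vertex forms a moved pair with every moved vertex; for small
    supports this nearly doubles the bound. *)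
Lemma card_moved n (s : 'S_n) :
  (#|supp s| * (n - 2) + #|supp s| * (n - #|supp s|) <= 2 * #|moved s|)%N.
Proof.
rewrite -sum_incident (bigID (mem (supp s))) /= leq_add //.
  rewrite -sum_nat_const; apply: leq_sum => i; rewrite inE => sii.
  apply: leq_trans (card_incident _ _ i (~: [set i; s i]) _).
    by rewrite cardsCs finset.setCK card_ord cards2 eq_sym sii.
  move=> j; rewrite !inE negb_or => /andP[ji jsi].
  have ij : i != j by rewrite eq_sym.
  by exists ij; apply: mkpair_moved => //; rewrite eq_sym.
have -> : (#|supp s| * (n - #|supp s|) = \sum_(i in ~: supp s) #|supp s|)%N.
  by rewrite sum_nat_const [#|~: _|]cardsCs finset.setCK card_ord mulnC.
rewrite [leqLHS](eq_bigl (fun i => i \notin supp s)) => [|i]; last by rewrite inE.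
apply: leq_sum => i; rewrite inE negbK => /eqP sii.
apply: card_incident => j; rewrite inE => sjj.
have ji : j != i by apply: contraNneq sjj => ->; rewrite sii.
have ij : i != j by rewrite eq_sym.
exists ij; rewrite (mkpair_sym _ _ _ ij ji); apply: mkpair_moved => //.
by rewrite -[X in _ != X]sii (inj_eq (@perm_inj _ _)).
Qed.

Lemma card_touching n (S : {set 'I_n}) : (#|S| * (n - 1) <= 2 * #|touching S|)%N.
Proof.
rewrite -sum_incident -sum_nat_const [leqRHS](bigID (mem S)) /=.
apply: leq_trans (leq_addr _ _); apply: leq_sum => i iS.
apply: leq_trans (card_incident _ _ i (~: [set i]) _).
  by rewrite cardsCs finset.setCK card_ord cards1.
move=> j; rewrite !inE eq_sym => ij; exists ij; rewrite inE.
by apply/set0Pn; exists i; rewrite !inE eqxx.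
Qed.

Lemma moved_touching n (s : 'S_n) : moved s \subset touching (supp s).
Proof.
apply/fintype.subsetP => e; rewrite !inE; apply: contraNneq => e0.
apply/eqP/val_inj => /=; rewrite -[RHS]imset_id; apply: eq_in_imset => x xe /=.
by move/setP: e0 => /(_ x); rewrite !inE xe /=; case: eqP.
Qed.

(** A pair that contains a moved vertex [i] and is preserved by [s] must be [{i, s i}]. *)
Lemma card_touching_fixed n (s : 'S_n) :
  (#|touching (supp s) :\: moved s| <= #|supp s|)%N.
Proof.
apply: leq_trans (leq_imset_card (fun i => [set i; s i]) _).
rewrite -(card_imset _ (@val_inj _ _ (vpair n))); apply/subset_leq_card/fintype.subsetP => A /imsetP[e].
rewrite !inE negbK => /andP[/eqP se /set0Pn[i]]; rewrite !inE => /andP[ie sii] ->.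
apply/imsetP; exists i; rewrite ?inE //.
apply/eqP; rewrite eq_sym eqEcard (eqP (valP e)) cards2 eq_sym sii leqnn andbT.
apply/fintype.subsetP => x; rewrite !inE => /orP[] /eqP -> //.
by rewrite -se /= imset_f.
Qed.

(** Passing to a set of pairs that depends only on the support costs at most one edge per moved
    vertex. *)
Lemma common_edges_touching n (s : 'S_n) (G : graph n * graph n) :
  (common_edges (touching (supp s)) G <= common_edges (moved s) G + #|supp s|)%N.
Proof.
rewrite /common_edges (big_setID (moved s)) /= (finset.setIidPr (moved_touching _ _)) leq_add2l.
apply: leq_trans (card_touching_fixed _ s); rewrite -sum1_card.
by apply: leq_sum => e _; case: (_ && _).
Qed.

(** Choose the support, then one of at most [k!] permutations of it: the product of the two counts
    is the falling factorial of [n], at most [n ^ k]. *)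
Lemma card_perm_supp n k : (#|[set s : 'S_n | #|supp s| == k]| <= n ^ k)%N.
Proof.
rewrite -sum1_card (partition_big supp (fun A : {set 'I_n} => #|A| == k)) /=; last first.
  by move=> s; rewrite inE.
apply: (@leq_trans (\sum_(A : {set 'I_n} | #|A| == k) k`!)%N).
  apply: leq_sum => A /eqP Ak; rewrite -{2}Ak -card_perm sum1dep_card.
  apply/subset_leq_card/fintype.subsetP => s; rewrite !inE => /andP[_ /eqP <-].
  by apply/fintype.subsetP => i; rewrite !inE.
rewrite sum_nat_const; have := cards_draws [set: 'I_n] k; rewrite cardsT card_ord => bk.
have -> : #|[pred A : {set 'I_n} | #|A| == k]| = 'C(n, k).
  by rewrite -bk; apply: eq_card => A; rewrite !inE finset.subsetT.
rewrite bin_ffact; elim: k {bk} n => [|k IH] [|m] //.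
rewrite ffactSS expnS leq_mul2l /=.
apply: leq_trans (IH m) _.
by case: k {IH} => // k; rewrite leq_exp2r.
Qed.

(** * The estimator *)

Definition score {n} (x : graph n * graph n) (s : 'S_n) : nat :=
  \sum_e (x.1 (perm_pair s e) && x.2 e).

(** [s * pi^-1] is the misalignment of the candidate [s] with respect to the truth [pi]. The pairs
    it fixes contribute equally to the scores of [s] and [pi], so only moved pairs matter in a
    comparison. *)
Lemma score_anonymize n (G : graph n * graph n) (pi s : 'S_n) :
  score (anonymize pi G.1, G.2) s =
  (spurious_edges (s * pi^-1) G + common_edges (~: moved (s * pi^-1)%g) G)%N.
Proof.
rewrite /score (bigID (mem (moved (s * pi^-1)%g))) /=; congr addn.
  by apply: eq_bigr => e _; rewrite ffunE -perm_pairM.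
apply: eq_big => [e|e]; first by rewrite finset.in_setC.
by rewrite inE negbK => /eqP se; rewrite ffunE -perm_pairM se.
Qed.

Lemma score_anonymize_id n (G : graph n * graph n) (pi s : 'S_n) :
  score (anonymize pi G.1, G.2) pi =
  (common_edges (moved s) G + common_edges (~: moved s) G)%N.
Proof.
rewrite /score (bigID (mem (moved s))) /=; congr addn.
  by apply: eq_bigr => e _; rewrite ffunE -perm_pairM mulgV perm_pair1.
apply: eq_big => [e|e _]; first by rewrite finset.in_setC.
by rewrite ffunE -perm_pairM mulgV perm_pair1.
Qed.

Fact dirac_fdist_ge0 (R : realType) (A : finType) (a0 a : A) : 0 <= (a == a0)%:R :> R.
Proof. exact: ler0n. Qed.

Fact dirac_fdist_sum1 (R : realType) (A : finType) (a0 : A) :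
  \sum_a (a == a0)%:R = 1 :> R.
Proof. by rewrite (bigD1 a0) //= eqxx big1 ?addr0 // => a /negbTE ->. Qed.

Definition dirac_fdist (R : realType) (A : finType) (a0 : A) : fdist R A :=
  Fdist (dirac_fdist_ge0 R A a0) (dirac_fdist_sum1 R A a0).

(** Ties count as confusions, so outside these events the true permutation is the only maximizer of
    the score. *)
Definition confusable {n} (s : 'S_n) : pred (graph n * graph n) :=
  fun G => (common_edges (moved s) G <= spurious_edges s G)%N.

Lemma exists_estimator (R : realType) n (p : fdist R (bool * bool)%type) :
  exists est : estimator R n,
    1 - Pr (ER n p) (fun G => [exists s : 'S_n, (s != 1%g) && confusable s G])
    <= Pr_correct p est.
Proof.
(* Here [1%g] only witnesses that the maximum is over a nonempty set. *)
pose best (x : graph n * graph n) : 'S_n := [arg max_(s > 1%g) score x s]%N.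
exists (fun x => dirac_fdist R _ (best x)).
have bestP (G : graph n * graph n) (pi : 'S_n) :
    ~~ [exists s : 'S_n, (s != 1%g) && confusable s G] ->
    best (anonymize pi G.1, G.2) = pi.
  move=> good; rewrite /best; case: arg_maxnP => // s _ /(_ pi isT).
  rewrite (score_anonymize _ G pi s) (score_anonymize_id _ G pi (s * pi^-1)%g) /geq /= leq_add2r => le.
  apply/eqP; rewrite eq_mulgV1; apply: contraNT good => s1.
  by apply/existsP; exists (s * pi^-1)%g; rewrite s1.
set bad := fun G => _.
have -> : 1 - Pr (ER n p) bad = Pr (ER n p) (predC bad).
  by rewrite -(Defs.pmf_sum1 (ER n p)) (bigID bad) /= addrC addrK.
rewrite /Pr_correct /Pr.
apply: (@le_trans _ _ (\sum_(G | ~~ bad G) \sum_(pi : 'S_n)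
   ER n p G * unif_perm R n pi *
   dirac_fdist R _ (best (anonymize pi G.1, G.2)) pi)).
  (* For a good pair of graphs every [pi] is recovered, so the conditional probability of success is
     1. *)
  apply: ler_sum => G good; rewrite -[leLHS]mulr1 -(Defs.pmf_sum1 (unif_perm R n)) big_distrr /=.
  by apply: ler_sum => pi _; rewrite bestP // eqxx mulr1.
apply: (@le_trans _ _ (\sum_G \sum_(pi : 'S_n)
   ER n p G * unif_perm R n pi *
   dirac_fdist R _ (best (anonymize pi G.1, G.2)) pi)).
  rewrite [leRHS](bigID bad) /= lerDr; apply: sumr_ge0 => G _; apply: sumr_ge0 => pi _.
  by rewrite !mulr_ge0 ?ler0n ?invr_ge0 ?ler0n //; apply: (Defs.pmf_ge0 (ER n p) G).
rewrite pair_bigA /= [leRHS]big_mkcond /= -[leRHS](pair_bigA _ (fun x s => if s == x.2 then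
  ER n p x.1 * unif_perm R n x.2 * dirac_fdist R _ (best (anonymize x.2 x.1.1, x.1.2)) s else 0)) /=.
apply: ler_sum => x _.
by rewrite (bigD1 x.2) //= eqxx [X in _ + X]big1 ?addr0 // => s /negbTE ->.
Qed.

(** * Tail bounds *)

Lemma fdist2_sum1 (R : realType) (p : fdist R (bool * bool)%type) :
  p (true, true) + p (true, false) + p (false, true) + p (false, false) = 1.
Proof.
have : \sum_x \sum_y p (x, y) = 1.
  by rewrite pair_bigA -(Defs.pmf_sum1 p); apply: eq_bigr => -[].
by rewrite !big_bool /=; lra.
Qed.

(** Chernoff bound for spurious minus common edges: [mgf_moved] with [u = z^-1] and
    [c = expR (- D)], where [D] is the rate in the exponent. *)
Lemma Pr_confusable_le (R : realType) n (p : fdist R (bool * bool)%type) (s : 'S_n) (z : R) :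
  1 <= z -> 0 < p (false, false) -> 0 < p (true, true) ->
  Pr (ER n p) (confusable s) <=
  expR (- (p (false, false) * p (true, true) * (1 - z^-1)
           - p (false, true) * p (true, false) * (z - 1)) * #|moved s|%:R).
Proof.
move=> z1 p00 p11; set D := _ - _.
have z0 : 0 < z by lra.
have mom := @mgf_moved R n p s z z^-1 (expR (- D)) z0.
apply: le_trans (Pr_le_mean _ _ _ _ (fun G => z ^+ spurious_edges s G *
   z^-1 ^+ common_edges (moved s) G) _ _) _.
- by move=> G; rewrite mulr_ge0 ?exprn_ge0 ?invr_ge0 // ltW.
- move=> G; rewrite /confusable => XY.
  by rewrite exprVn -expfB_cond ?gt_eqF // exprn_ege1.
apply: le_trans (mom _ _ _ _ _) _ => {mom}; rewrite ?invr_gt0 ?expR_ge0 //; last first.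
  by rewrite expRM_natr.
have p1 := fdist2_sum1 _ p.
(* The trace of the squared transfer matrix is exactly [1 - 2 * D]. *)
have -> : expR (- D) ^+ 2 = expR (- D * 2%:R) by rewrite expRM_natr.
apply: le_trans (expR_ge1Dx _); rewrite le_eqVlt; apply/orP; left; apply/eqP.
rewrite /D.
move: (p (true, true)) (p (true, false)) (p (false, true)) (p (false, false)) p1
  => x11 x10 x01 x00 p1.
have -> : x00 = 1 - x11 - x10 - x01 by rewrite -p1; ring.
by field; rewrite gt_eqF.
Qed.

(** Chernoff bound for the spurious edges alone: [mgf_moved] with [z = expR a] and [u = 1]. The
    smallness of [delta] keeps the trace of the squared matrix below [1 + 2 * p (true, true)]. *)
Lemma Pr_many_spurious_le (R : realType) n (p : fdist R (bool * bool)%type) (s : 'S_n)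
    (t delta a : R) :
  0 < p (false, false) -> 0 < p (true, true) -> 0 <= a ->
  p (true, true) <= delta -> p (false, true) + p (true, false) <= delta ->
  p (false, true) * p (true, false) <= delta * p (true, true) ->
  4 * expR a ^+ 2 * delta <= 1 ->
  Pr (ER n p) (fun G => t <= (spurious_edges s G)%:R) <=
  expR (- (a * t) + p (true, true) * #|moved s|%:R).
Proof.
move=> p00 p11 a0 d11 d d01 small.
have mom := @mgf_moved R n p s (expR a) 1 (expR (p (true, true))) (expR_gt0 _).
apply: le_trans (Pr_le_mean _ _ _ _ (fun G => expR (- (a * t)) *
   (expR a ^+ spurious_edges s G * 1 ^+ common_edges (moved s) G)) _ _) _.
- by move=> G; rewrite !mulr_ge0 ?exprn_ge0 ?expR_ge0.
- move=> G tX; rewrite expr1n mulr1 -expRM_natr -expRD -[leLHS]expR0 ler_expR.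
  by rewrite addrC subr_ge0 ler_wpM2l.
under eq_bigr => G _ do rewrite mulrCA.
rewrite -big_distrr /= expRD ler_wpM2l ?expR_ge0 //.
apply: le_trans (mom _ _ _ _ _) _ => {mom}; rewrite ?expR_ge0 //; last first.
  by rewrite expRM_natr.
have p1 := fdist2_sum1 _ p.
have -> : expR (p (true, true)) ^+ 2 = expR (p (true, true) * 2%:R) by rewrite expRM_natr.
apply: le_trans (expR_ge1Dx _).
have z1 : 1 <= expR a by rewrite -expR0 ler_expR.
move: (expR a) z1 small => z z1 small.
have q01 := Defs.pmf_ge0 p (false, true); have q10 := Defs.pmf_ge0 p (true, false).
move: (p (true, true)) (p (true, false)) (p (false, true)) (p (false, false))
  p00 p11 d11 d d01 p1 q01 q10 => x11 x10 x01 x00 p00 p11 d11 d d01 p1 q01 q10.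
have x00E : x00 = 1 - x11 - x10 - x01 by lra.
have -> : (x00 + x01) ^+ 2 + 2 * ((x00 + z * x01) * (x10 + 1 * x11)) + (x10 + z * 1 * x11) ^+ 2
  = 1 + (z - 1) ^+ 2 * x11 ^+ 2 +
    2 * (z - 1) * (x11 * (x11 + (x01 + x10)) + x01 * x10).
  by rewrite x00E; ring.
have b1 : x11 * (x11 + (x01 + x10)) + x01 * x10 <= 3 * (delta * x11).
  have : x11 * (x11 + (x01 + x10)) <= x11 * (delta + delta) by rewrite ler_pM2l //; lra.
  lra.
have b2 : x11 ^+ 2 <= delta * x11 by rewrite expr2 ler_pM2r.
have b3 : (z - 1) ^+ 2 * x11 ^+ 2 <= (z - 1) ^+ 2 * (delta * x11).
  by rewrite ler_wpM2l ?sqr_ge0.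
have b4 : 2 * (z - 1) * (x11 * (x11 + (x01 + x10)) + x01 * x10) <=
   2 * (z - 1) * (3 * (delta * x11)) by rewrite ler_wpM2l //; lra.
(* With [b6] the excess of the trace over 1 is at most [7 / 4 * x11], below the required
   [2 * x11]. *)
have b5 : ((z - 1) ^+ 2 + 6 * (z - 1)) * (delta * x11) <= 7 * z ^+ 2 * (delta * x11).
  apply: ler_wpM2r; last by nra.
    by apply: mulr_ge0; lra.
have b6 : 4 * z ^+ 2 * delta * x11 <= 1 * x11 by rewrite ler_pM2r.
lra.
Qed.

Lemma expRN1_le_half (R : realType) : expR (-1) <= 1 / 2 :> R.
Proof.
rewrite expRN div1r lef_pV2 ?posrE ?expR_gt0 //.
by have := expR_ge1Dx (1 : R); lra.
Qed.

(** Lower-tail Chernoff bound with [u = expR (-1)]: since [1 - u >= 1 / 2], each pair contributes at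
    most [expR (- p11 / 2)], that is [expR (- 2 t)] in total, against the prefactor [expR t]. *)
Lemma Pr_few_common_le (R : realType) n (p : fdist R (bool * bool)%type)
    (M : {set vpair n}) :
  Pr (ER n p) (fun G => (common_edges M G)%:R < #|M|%:R * p (true, true) / 4) <=
  expR (- (#|M|%:R * p (true, true) / 4)).
Proof.
set t := _ / 4.
apply: le_trans (Pr_le_mean _ _ _ _ (fun G => expR t * expR (-1) ^+ common_edges M G) _ _) _.
- by move=> G; rewrite !mulr_ge0 ?exprn_ge0 ?expR_ge0.
- by move=> G Yt; rewrite -expRM_natr -expRD -[leLHS]expR0 ler_expR mulN1r subr_ge0 ltW.
under eq_bigr => G _ do rewrite mulrCA.
rewrite -big_distrr /= mgf_common.
have p11 := Defs.pmf_ge0 p (true, true).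
have p10 := Defs.pmf_ge0 p (true, false).
have p01 := Defs.pmf_ge0 p (false, true).
have p00 := Defs.pmf_ge0 p (false, false).
have p1 := fdist2_sum1 _ p.
have h := expRN1_le_half R; have h0 := expR_ge0 (-1 : R).
have -> : - t = t + - (p (true, true) / 2) * #|M|%:R by rewrite /t; lra.
rewrite expRD ler_wpM2l ?expR_ge0 // expRM_natr lerXn2r ?nnegrE ?expR_ge0 //.
  by rewrite subr_ge0; nra.
by apply: le_trans (expR_ge1Dx _); nra.
Qed.

Lemma Pr_exists_le (R : realType) (A I : finType) (d : fdist R A) (Q : I -> pred A) (P : pred I) :
  Pr d (fun a => [exists i, P i && Q i a]) <= \sum_(i | P i) Pr d (Q i).
Proof.
rewrite /Pr; under [leRHS]eq_bigr => i _ do rewrite big_mkcond.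
rewrite exchange_big /= big_mkcond /=; apply: ler_sum => a _.
have nn i : 0 <= (if Q i a then d a else 0) by case: ifP => // _; apply: Defs.pmf_ge0.
case: ifP => [/existsP[i /andP[Pi Qi]]|_]; last exact: sumr_ge0.
by rewrite (bigD1 i) //= Qi lerDl sumr_ge0.
Qed.

Lemma Pr_or_le (R : realType) (A : finType) (d : fdist R A) (P Q1 Q2 : pred A) :
  (forall a, P a -> Q1 a || Q2 a) -> Pr d P <= Pr d Q1 + Pr d Q2.
Proof.
move=> PQ; rewrite /Pr (big_mkcond P) (big_mkcond Q1) (big_mkcond Q2) /= -big_split /=.
apply: ler_sum => a _; have := PQ a; have := Defs.pmf_ge0 d a.
by case: (P a); case: (Q1 a); case: (Q2 a) => //= d0 H; try lra; have := H isT.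
Qed.

(** * Small and large supports *)

(** Taking [z = L], the exponent is [k * n * p11] up to relative losses of order [1 / L]. As
    [n * p11 >= L + w], these losses cost only a constant per moved vertex and at most half of
    [w]. *)
Lemma Pr_confusable_small (R : realType) n (p : fdist R (bool * bool)%type) (s : 'S_n)
    (C L w : R) :
  1 <= C -> 0 <= w -> 2 * (18 + 3 * C) <= L -> L <= n%:R -> (2 <= n)%N ->
  (L + w) / n%:R <= p (true, true) -> p (true, true) <= C / L ->
  p (false, true) + p (true, false) <= C / L ->
  p (false, true) * p (true, false) <= C / L ^+ 3 * (p (true, true) * p (false, false)) ->
  #|supp s|%:R <= 32 * n%:R / L ->
  Pr (ER n p) (confusable s) <= expR (- (#|supp s|%:R * (L + w / 2 - (18 + 3 * C)))).
Proof.
move=> C1 w0 LB Ln n2 p11g p11l p01l ratio ks.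
have n0 : 0 < n%:R :> R by rewrite ltr0n; case: n n2 {Ln p11g ks s}.
have L0 : 0 < L by lra.
have p1 := fdist2_sum1 _ p.
set p11 := p (true, true) in p1 p11g p11l ratio *.
set p10 := p (true, false) in p1 p01l ratio *.
set p01 := p (false, true) in p1 p01l ratio *.
set p00 := p (false, false) in p1 ratio *.
pose x := L^-1.
have x0 : 0 < x by rewrite invr_gt0.
have Lx : L * x = 1 by rewrite mulfV ?gt_eqF.
have Bx : 2 * (18 + 3 * C) * x <= 1 by rewrite -[leRHS]Lx ler_pM2r.
have Cx : C / L = C * x by [].
have CL3 : C / L ^+ 3 = C * x ^+ 3 by rewrite exprVn.
rewrite {}Cx in p11l p01l; rewrite {}CL3 in ratio.
have p00g : 1 - 2 * C * x <= p00 by lra.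
have p00p : 0 < p00 by lra.
have p11p : 0 < p11 by apply: lt_le_trans p11g; rewrite divr_gt0 //; lra.
apply: le_trans (Pr_confusable_le _ _ _ s L _ _ _) _ => //; first lra.
rewrite ler_expR mulNr lerN2 -/p00 -/p11 -/p01 -/p10 -/x.
set k := #|supp s|%:R in ks *; set m := #|moved s|%:R.
have k0 : 0 <= k by rewrite ler0n.
have kn : k <= n%:R by rewrite ler_nat -[leqRHS]card_ord max_card.
have mk : k * (n%:R - 2) + k * (n%:R - k) <= 2 * m.
  have := card_moved _ s; rewrite -(ler_nat R) natrD !natrM !natrB //.
  by rewrite -(ler_nat R).
have xn : 1 <= x * n%:R by rewrite -[leLHS]Lx mulrC ler_pM2l.
have ks' : k <= 32 * n%:R * x by [].
(* The loss [17 * x] is [16 * x] from [k <= 32 * n * x] and [x] from [1 <= x * n]. *)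
have mk' : k * n%:R * (1 - 17 * x) <= m.
  have h1 : k * k <= k * (32 * n%:R * x) by rewrite ler_wpM2l.
  have h2 : k * 1 <= k * (x * n%:R) by rewrite ler_wpM2l.
  lra.
(* The loss [(1 + 3 * C) * x] collects [2 * C * x] from [p00], [x] from [1 - z^-1], and [C * x] from
   the ratio hypothesis. *)
have D : p11 * (1 - (1 + 3 * C) * x) <= p00 * p11 * (1 - x) - p01 * p10 * (L - 1).
  have h1 : p01 * p10 * (L - 1) <= p01 * p10 * L.
    by rewrite ler_wpM2l ?mulr_ge0 ?Defs.pmf_ge0 //; lra.
  have h2 : p01 * p10 * L <= C * x ^+ 3 * (p11 * p00) * L by rewrite ler_pM2r.
  have h3 : C * x ^+ 3 * (p11 * p00) * L = C * x ^+ 2 * (p11 * p00).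
    by rewrite -[RHS]mulr1 -[X in _ = _ * X]Lx; ring.
  have h4 : C * x ^+ 2 * (p11 * p00) <= C * x * (p11 * p00).
    rewrite ler_pM2r ?mulr_gt0 // expr2 mulrA -[leRHS]mulr1 ler_wpM2l //; last by lra.
    by rewrite mulr_ge0 //; lra.
  have h5 : p11 * (1 - (1 + 3 * C) * x) <= p11 * (p00 * (1 - x - C * x)).
    rewrite ler_pM2l //.
    have : (1 - 2 * C * x) * (1 - x - C * x) <= p00 * (1 - x - C * x).
      by rewrite ler_wpM2r //; nra.
    by nra.
  lra.
have a1 : 0 <= 1 - (1 + 3 * C) * x by nra.
have a2 : 0 <= 1 - 17 * x by nra.
apply: (@le_trans _ _ (p11 * (1 - (1 + 3 * C) * x) * (k * n%:R * (1 - 17 * x)))); last first.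
  apply: ler_pM => //; first by rewrite mulr_ge0 // ltW.
  by rewrite !mulr_ge0 // ltW.
have np : L + w <= n%:R * p11 by rewrite mulrC -ler_pdivrMr.
have -> : p11 * (1 - (1 + 3 * C) * x) * (k * n%:R * (1 - 17 * x)) =
  k * (n%:R * p11 * ((1 - (1 + 3 * C) * x) * (1 - 17 * x))) by ring.
apply: ler_wpM2l => //.
have b : 1 - (18 + 3 * C) * x <= (1 - (1 + 3 * C) * x) * (1 - 17 * x).
  have : 0 <= (1 + 3 * C) * x * (17 * x) by rewrite !mulr_ge0 //; lra.
  lra.
apply: (@le_trans _ _ ((L + w) * (1 - (18 + 3 * C) * x))); last first.
  by apply: ler_pM => //; lra.
have : w * ((18 + 3 * C) * x) <= w * (1 / 2) by rewrite ler_wpM2l //; lra.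
have : L * ((18 + 3 * C) * x) = 18 + 3 * C by rewrite mulrCA Lx mulr1.
lra.
Qed.

Lemma Pr_spurious_large (R : realType) n (p : fdist R (bool * bool)%type) (s : 'S_n)
    (C L : R) :
  1 <= C -> 4 * expR 72 ^+ 2 * C <= L -> (2 <= n)%N ->
  L / n%:R <= p (true, true) -> p (true, true) <= C / L ->
  p (false, true) + p (true, false) <= C / L ->
  p (false, true) * p (true, false) <= C / L ^+ 3 * (p (true, true) * p (false, false)) ->
  Pr (ER n p) (fun G => #|touching (supp s)|%:R * p (true, true) / 8
                        <= (spurious_edges s G)%:R)
  <= expR (- (2 * #|supp s|%:R * L)).
Proof.
move=> C1 LB n2 p11g p11l p01l ratio.
have n0 : 0 < n%:R :> R by rewrite ltr0n; case: n n2 {p11g s}.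
have e1 : 1 <= expR 72 :> R by rewrite -expR0 ler_expR.
have LC : 4 * C <= L.
  apply: le_trans LB; rewrite ler_wpM2r //; first by lra.
  by rewrite ler_peMr // exprn_ege1.
have L4 : 4 <= L by lra.
have L0 : 0 < L by lra.
have CL : C / L <= 1 / 4.
  by rewrite ler_pdivrMr //; lra.
have p1 := fdist2_sum1 _ p.
have p00p : 0 < p (false, false) by lra.
have p11p : 0 < p (true, true) by apply: lt_le_trans p11g; rewrite divr_gt0.
set mS := #|touching _|%:R.
(* With [a = 72] the exponent is at most [- 9 * mS * p11 + mS * p11 = - 8 * mS * p11], and
   [mS * p11 >= k * L / 4] with [k] the size of the support. *)
apply: le_trans (Pr_many_spurious_le _ _ _ s _ (C / L) 72 _ _ _ _ _ _ _) _ => //.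
- apply: le_trans ratio _.
  have c0 : 0 <= C / L by rewrite divr_ge0; lra.
  rewrite mulrA; apply: (@le_trans _ _ (C / L ^+ 3 * p (true, true) * 1)).
    apply: ler_wpM2l; last by have := Defs.pmf_ge0 p (false, true); have := Defs.pmf_ge0 p (true, false); lra.
    by rewrite mulr_ge0 ?divr_ge0 ?exprn_ge0 //; lra.
  rewrite mulr1 ler_pM2r // ler_wpM2l //; first by lra.
  rewrite lef_pV2 ?posrE ?exprn_gt0 // -[leLHS]expr1 ler_weXn2l //; lra.
- by rewrite mulrA ler_pdivrMr // mul1r.
have mSm : #|moved s|%:R <= mS by rewrite ler_nat; apply/subset_leq_card/moved_touching.
have mSk : #|supp s|%:R * (n%:R - 1) <= 2 * mS.
  have := card_touching _ (supp s); rewrite -(ler_nat R) !natrM !natrB //.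
  by apply: leq_trans n2.
have k0 : 0 <= #|supp s|%:R :> R by rewrite ler0n.
have n2' : 2 <= n%:R :> R by rewrite (ler_nat R 2).
rewrite ler_expR.
have np : L <= n%:R * p (true, true) by rewrite mulrC -ler_pdivrMr.
have h1 : p (true, true) * #|moved s|%:R <= p (true, true) * mS by rewrite ler_pM2l.
have h2 : #|supp s|%:R * (n%:R - 1) * p (true, true) <= 2 * mS * p (true, true).
  by rewrite ler_pM2r.
have h3 : #|supp s|%:R * (L / 2) <= #|supp s|%:R * ((n%:R - 1) * p (true, true)).
  by rewrite ler_wpM2l //; nra.
lra.
Qed.

(** * Union bounds *)

(** The at most [n ^ k] permutations with support of size [k] contribute at most [q ^ k].
    Nonidentity permutations have [k >= 1], which leaves a geometric series bounded by [2 * q]. *)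
Lemma sum_perm_le (R : realType) n (q : R) (f : 'S_n -> R) :
  0 <= q -> q <= 1 / 2 -> (0 < n)%N ->
  (forall s, f s <= (q / n%:R) ^+ #|supp s|) ->
  \sum_(s : 'S_n | s != 1%g) f s <= 2 * q.
Proof.
move=> q0 q1 n0 fq.
have n0' : 0 < n%:R :> R by rewrite ltr0n.
have supp0 s : s != 1%g -> (0 < #|@supp n s| < n.+1)%N.
  move=> s1; apply/andP; split; last by rewrite ltnS -[leqRHS]card_ord max_card.
  rewrite card_gt0.
  apply: contraNneq s1 => s0; apply/eqP/permP => i; rewrite perm1.
  by have /setP/(_ i) := s0; rewrite !inE => /negbFE/eqP.
pose ks (s : 'S_n) : 'I_n.+1 := inord #|supp s|.
apply: (@le_trans _ _ (\sum_(k < n.+1 | (0 < k)%N) q ^+ k)).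
  rewrite (partition_big ks (fun k : 'I_n.+1 => (0 < k)%N)) /=; last first.
    by move=> s /supp0 /andP[s0 sn]; rewrite inordK.
  apply: ler_sum => k k0.
  apply: (@le_trans _ _ (\sum_(s in [set s : 'S_n | #|supp s| == k]) (q / n%:R) ^+ k)).
    rewrite [leRHS]big_mkcond [leLHS]big_mkcond /=; apply: ler_sum => s _.
    rewrite inE; case: ifPn => [/andP[/supp0 /andP[_ sn] /eqP <-]|_].
      by rewrite inordK // eqxx fq.
    by case: ifP => // _; rewrite exprn_ge0 // divr_ge0 // ltW.
  rewrite sumr_const -[leLHS]mulr_natl.
  apply: (@le_trans _ _ ((n ^ k)%:R * (q / n%:R) ^+ k)).
    by rewrite ler_wpM2r ?ler_nat ?card_perm_supp // exprn_ge0 // divr_ge0 // ltW.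
  by rewrite natrX -exprMn mulrCA mulfV ?gt_eqF // mulr1.
rewrite big_mkcond big_ord_recl /= add0r.
have : (1 - q) * (\sum_(i < n) q ^+ i) <= 1.
  by rewrite -opprB mulNr -subrX1 opprB lerBlDr lerDl exprn_ge0.
under eq_bigr => i _ do rewrite exprS.
rewrite -big_distrr /=.
have : 0 <= \sum_(i < n) q ^+ i by apply: sumr_ge0 => i _; rewrite exprn_ge0.
by move: (\sum_(i < n) _) => S S0 S1; nra.
Qed.

(** The first term of [q] pays for permutations of small support, the second for large ones, where
    [expR (- 2 k L) = (n^-1 / n) ^ k]. The separate [n^-1] pays for large vertex sets that touch few
    common edges. *)
Lemma Pr_error_le (R : realType) n (p : fdist R (bool * bool)%type) (C w : R)
    (L := ln n%:R) (q := expR (18 + 3 * C - w / 2) + n%:R^-1) :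
  1 <= C -> 0 <= w -> 2 * (18 + 3 * C) <= L -> 4 * expR 72 ^+ 2 * C <= L -> (2 <= n)%N ->
  (L + w) / n%:R <= p (true, true) -> p (true, true) <= C / L ->
  p (false, true) + p (true, false) <= C / L ->
  p (false, true) * p (true, false) <= C / L ^+ 3 * (p (true, true) * p (false, false)) ->
  q <= 1 / 2 ->
  Pr (ER n p) (fun G => [exists s : 'S_n, (s != 1%g) && confusable s G]) <= n%:R^-1 + 2 * q.
Proof.
move=> C1 w0 LB LE n2 p11g p11l p01l ratio q12.
have n2' : 2 <= n%:R :> R by rewrite (ler_nat R 2).
have n0 : 0 < n%:R :> R by lra.
have L42 : 42 <= L by lra.
have L0 : 0 < L by lra.
have nE : n%:R = expR L by rewrite /L lnK // posrE.
have Ln : L <= n%:R by rewrite nE; have := expR_ge1Dx L; lra.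
have p11L : L / n%:R <= p (true, true).
  by apply: le_trans p11g; rewrite ler_pM2r ?invr_gt0 //; lra.
have np11 : L <= n%:R * p (true, true) by rewrite mulrC -ler_pdivrMr.
have p110 : 0 < p (true, true) by apply: lt_le_trans p11L; rewrite divr_gt0.
pose big (S : {set 'I_n}) := 32 * n%:R / L < #|S|%:R.
pose few (S : {set 'I_n}) (G : graph n * graph n) :=
  (common_edges (touching S) G)%:R < #|touching S|%:R * p (true, true) / 4.
pose Q (s : 'S_n) (G : graph n * graph n) := if big (supp s)
  then #|touching (supp s)|%:R * p (true, true) / 8 <= (spurious_edges s G)%:R
  else confusable s G.
have touch (S : {set 'I_n}) : #|S|%:R * L / 4 <= #|touching S|%:R * p (true, true).
  have := card_touching _ S; rewrite -(ler_nat R) !natrM natrB; last exact: ltnW.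
  move=> h; have h' := ler_wpM2r (ltW p110) h.
  have : #|S|%:R * (L / 2) <= #|S|%:R * ((n%:R - 1) * p (true, true)).
    by rewrite ler_wpM2l //; nra.
  lra.
have split G : [exists s : 'S_n, (s != 1%g) && confusable s G] ->
    [exists S, big S && few S G] || [exists s : 'S_n, (s != 1%g) && Q s G].
  move=> /existsP[s /andP[s1 sG]]; apply/orP.
  case: (boolP (big (supp s))) => [bs|nbs]; last first.
    by right; apply/existsP; exists s; rewrite s1 /Q (negbTE nbs).
  case: (boolP (few (supp s) G)) => [fs|nfs].
    by left; apply/existsP; exists (supp s); rewrite bs fs.
  right; apply/existsP; exists s; rewrite s1 /Q bs /=.
  move: nfs; rewrite /few -leNgt => h1.
  have h2 : (common_edges (touching (supp s)) G)%:R <=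
      (spurious_edges s G)%:R + #|supp s|%:R :> R.
    rewrite -natrD ler_nat; apply: leq_trans (common_edges_touching _ _ _) _.
    by rewrite leq_add2r.
  have h3 := touch (supp s).
  (* Since [L >= 32], the [k] edges lost in passing to moved pairs are at most half of the
     guaranteed [mS * p11 / 4], whence the threshold [mS * p11 / 8] in [Q]. *)
  have h4 : #|supp s|%:R * 32 <= #|supp s|%:R * L :> R by rewrite ler_wpM2l //; lra.
  lra.
apply: le_trans (Pr_or_le _ _ _ _ _ _ split) _.
apply: lerD.
  apply: le_trans (Pr_exists_le _ _ _ _ few big) _.
  (* The threshold 32 in [big] makes the exponent [|S| * L / 16] at least [2 * n], which beats the
     [2 ^ n] vertex sets. *)
  apply: (@le_trans _ _ (\sum_(S : {set 'I_n}) expR (-2) ^+ n)).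
    rewrite [leLHS]big_mkcond; apply: ler_sum => S _; case: ifP => [bS|_]; last first.
      by rewrite exprn_ge0 ?expR_ge0.
    apply: le_trans (Pr_few_common_le _ _ _ _) _.
    rewrite -expRM_natr ler_expR.
    have h := touch S.
    have : 32 * n%:R <= #|S|%:R * L by rewrite -ler_pdivrMr // ltW.
    lra.
  rewrite sumr_const -[leLHS]mulr_natl -[#|_|]cardsT -powersetT card_powerset cardsT card_ord.
  rewrite natrX -exprMn.
  apply: (@le_trans _ _ (expR (-1) ^+ n)).
    rewrite lerXn2r ?nnegrE ?mulr_ge0 ?expR_ge0 //.
    have -> : -2 = -1 + -1 :> R by ring.
    by rewrite expRD mulrA ler_piMl ?expR_ge0 //; have := expRN1_le_half R; lra.
  rewrite -expRM_natr mulN1r expRN lef_pV2 ?posrE ?expR_gt0 //.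
  by have := expR_ge1Dx (n%:R : R); lra.
apply: le_trans (Pr_exists_le _ _ _ _ Q (fun s => s != 1%g)) _.
have n_inv0 : 0 < n%:R^-1 :> R by rewrite invr_gt0.
have e0 := expR_gt0 (18 + 3 * C - w / 2).
apply: sum_perm_le => //; [by rewrite /q; lra|exact: ltnW|move=> s].
have eL : expR (- L) = n%:R^-1 by rewrite expRN -nE.
rewrite /Q; case: (boolP (big (supp s))) => [bs|]; last first.
  rewrite /big -leNgt => ss.
  apply: le_trans (@Pr_confusable_small R n p s C L w _ _ _ _ _ _ _ _ _ _) _ => //.
  have -> : - (#|supp s|%:R * (L + w / 2 - (18 + 3 * C))) =
    (18 + 3 * C - w / 2 + - L) * #|supp s|%:R by ring.
  rewrite expRM_natr expRD eL lerXn2r ?nnegrE ?divr_ge0 ?expR_ge0 //; try by rewrite /q; lra.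
  by rewrite ler_pM2r // /q; lra.
apply: le_trans (@Pr_spurious_large R n p s C L _ _ _ _ _ _ _) _ => //.
have -> : - (2 * #|supp s|%:R * L) = (- L + - L) * #|supp s|%:R by ring.
rewrite expRM_natr expRD eL lerXn2r ?nnegrE ?divr_ge0 //; try by rewrite /q; lra.
by rewrite ler_pM2r // /q; lra.
Qed.

(** * Passage to the limit *)

Lemma Pr_le1 (R : realType) (A : finType) (d : fdist R A) (P : pred A) : Pr d P <= 1.
Proof.
rewrite -(Defs.pmf_sum1 d) /Pr [leRHS](bigID P) /= lerDl.
by apply: sumr_ge0 => a _; apply: Defs.pmf_ge0.
Qed.

Local Open Scope classical_set_scope.

Theorem theorem1 (R : realType) (p : nat -> fdist R (bool * bool)%type)
    (p11 := fun n => p n (true, true)) (p10 := fun n => p n (true, false))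
    (p01 := fun n => p n (false, true)) (p00 := fun n => p n (false, false))
    (w : nat -> R) (w_oo : w n @[n --> \oo] --> +oo)
    (p11_ge : \forall n \near \oo, (ln n%:R + w n) / n%:R <= p11 n)
    (p11_le : p11 =O_\oo (fun n => (ln n%:R)^-1 : R))
    (p01_p10_le : (fun n => p01 n + p10 n) =O_\oo (fun n => (ln n%:R)^-1 : R))
    (ratio_le : (fun n => p01 n * p10 n / (p11 n * p00 n))
                =O_\oo (fun n => (ln n%:R ^+ 3)^-1 : R)) :
  exists est : forall n, estimator R n,
    Pr_correct (p n) (est n) @[n --> \oo] --> (1 : R).
Proof.
pose est n := projT1 (cid (exists_estimator R n (p n))).
exists est.
move/eqOP: p11_le => h1; move/eqOP: p01_p10_le => h2; move/eqOP: ratio_le => h3.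
(* Any sufficiently large constant serves all three asymptotic bounds at once. *)
have [C [C1 c1 c2 c3]] : exists C : R, [/\ 1 <= C,
    \forall n \near \oo, `|p11 n| <= C * `|(ln n%:R)^-1|,
    \forall n \near \oo, `|p01 n + p10 n| <= C * `|(ln n%:R)^-1| &
    \forall n \near \oo, `|p01 n * p10 n / (p11 n * p00 n)| <= C * `|(ln n%:R ^+ 3)^-1|].
  by near (pinfty_nbhs R) => C; exists C; split; near: C => //; apply: nbhs_pinfty_ge; rewrite num_real.
apply/cvgrPdist_le => /= e e0.
(* Capping at 1 ensures [q <= e' / 4 <= 1 / 2]; the total error is then at most
   [e' / 8 + e' / 2]. *)
pose e' := Num.min e 1.
have e'0 : 0 < e' by rewrite lt_min e0 ltr01.
have e'1 : e' <= 1 by rewrite ge_min lexx orbT.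
have e'e : e' <= e by rewrite ge_min lexx.
(* The sum of the two lower bounds on [L] in [Pr_error_le], so that [K <= ln n] implies both. *)
pose K := 2 * (18 + 3 * C) + 4 * expR 72 ^+ 2 * C.
near=> n.
have n2 : (2 <= n)%N by near: n; exact: nbhs_infty_ge.
have n0 : 0 < n%:R :> R by rewrite ltr0n; apply: leq_trans n2.
have nK : expR K <= n%:R by near: n; exact: nbhs_infty_ger.
have ne : (e' / 8)^-1 <= n%:R by near: n; exact: nbhs_infty_ger.
have LK : K <= ln n%:R by rewrite -(expRK K) ler_ln ?posrE ?expR_gt0.
have w0 : 0 <= w n by near: n; move/cvgryPge: w_oo; apply.
have we : 2 * (18 + 3 * C - ln (e' / 8)) <= w n.
  by near: n; move/cvgryPge: w_oo; apply.
have ninv : n%:R^-1 <= e' / 8.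
  by rewrite -[leRHS]invrK lef_pV2 ?posrE // ?invr_gt0 divr_gt0.
have qe : expR (18 + 3 * C - w n / 2) <= e' / 8.
  rewrite -[leRHS]lnK ?posrE ?divr_gt0 // ler_expR.
  move: (ln (e' / 8)) we => l we; lra.
have E0 : 0 <= 4 * expR 72 ^+ 2 * C.
  by rewrite !mulr_ge0 ?exprn_ge0 ?expR_ge0 //; lra.
have L0 : 0 < ln n%:R :> R by apply: lt_le_trans LK; rewrite /K; lra.
have g11 : (ln n%:R + w n) / n%:R <= p n (true, true) by near: n.
have x11 : 0 < p n (true, true).
  by apply: lt_le_trans g11; rewrite divr_gt0 //; lra.
have l11 : p n (true, true) <= C / ln n%:R.
  have : `|p11 n| <= C * `|(ln n%:R)^-1| by near: n.
  by rewrite !ger0_norm ?invr_ge0 // ltW.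
have l01 : p n (false, true) + p n (true, false) <= C / ln n%:R.
  have : `|p01 n + p10 n| <= C * `|(ln n%:R)^-1| by near: n.
  by rewrite !ger0_norm ?invr_ge0 ?addr_ge0 ?Defs.pmf_ge0 // ltW.
have CL : C / ln n%:R <= 1 / 4.
  rewrite ler_pdivrMr //.
  have : 2 * (18 + 3 * C) <= ln n%:R by apply: le_trans LK; rewrite /K; lra.
  lra.
(* Positivity allows the denominator of the ratio hypothesis to be cleared. *)
have x00 : 0 < p n (false, false) by have := fdist2_sum1 _ (p n); lra.
have l3 : p n (false, true) * p n (true, false) <=
    C / ln n%:R ^+ 3 * (p n (true, true) * p n (false, false)).
  rewrite -ler_pdivrMr ?mulr_gt0 //.
  have : `|p01 n * p10 n / (p11 n * p00 n)| <= C * `|(ln n%:R ^+ 3)^-1| by near: n.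
  by rewrite !ger0_norm ?invr_ge0 ?exprn_ge0 ?divr_ge0 ?mulr_ge0 ?Defs.pmf_ge0 // ltW.
have err := @Pr_error_le R n (p n) C (w n) C1 w0 _ _ n2 g11 l11 l01 l3 _.
have := projT2 (cid (exists_estimator R n (p n))); rewrite -/(est n) => ok.
have ub := Pr_le1 _ _ (experiment (p n) (est n)) (fun x => x.2 == x.1.2).
rewrite ger0_norm ?subr_ge0 //.
apply: (@le_trans _ _ (n%:R^-1 + 2 * (expR (18 + 3 * C - w n / 2) + n%:R^-1))); last by lra.
rewrite lerBlDr -lerBlDl; apply: le_trans ok.
rewrite lerB //; apply: err; last by lra.
- by apply: le_trans LK; rewrite /K; lra.
- by apply: le_trans LK; rewrite /K; lra.
Unshelve. all: by end_near.
Qed.
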